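(* Let $n\ge 0$ be an integer, let $c_0\in\mathbb{R}$, and let $p,q$ be the strict Laurent polynomials with integer coefficients such that $y_n(x)=p(x)\cos x+q(x)\sin x$ for all real $x\neq 0$, where $y_n$ is the spherical Bessel function of the second kind. Let $x_{n,m}$ denote the $m$-th infsupum abscissa of $y_n$, and let $B$ be the set of all real branch numbers $b$ of $\mathrm{inverse}_b(y_n)$ for which the interval with endpoints $y_n(x_{n,b-1})$ and $y_n(x_{n,b})$ (the first endpoint included when finite, the second excluded) contains $c_0$. Then the set of all real solutions $x$ of the equation $$p(x)\cos x+q(x)\sin x=c_0$$ is exactly $$\{\,\mathrm{inverse}_b(y_n)(c_0) : b\in B\,\}$$ (which is empty if $B$ is empty).
   Context: A strict univariate Laurent polynomial is either $0$ or a finite sum of terms, each a numeric coefficient times a negative integer power of the variable. For integer $n\ge 0$ and real $x\ne 0$, $y_n(x)=-(-x)^n\left(\frac1x\frac{d}{dx}\right)^n\frac{\cos x}{x}$. Equivalently $y_0(x)=-\frac{\cos x}{x}$, $y_1(x)=-\frac{\cos x}{x^2}-\frac{\sin x}{x}$, and $y_{n+1}(x)=\frac{2n+1}{x}y_n(x)-y_{n-1}(x)$. Each $y_n$ is thus of the form $p(x)\cos x+q(x)\sin x$ with $p,q$ strict Laurent polynomials with integer coefficients. Infsupum abscissas and branches of a function $f$: the real $x$ where $f$ is defined are partitioned into maximal intervals on which $f$ is continuous and monotonic. The endpoints of these intervals (abscissas of local infima and suprema of $f$, including the pole at $x=0$ if there is one) are called the infsupum abscissas. They are numbered consecutively in increasing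 order by integers $m$, so that number $1$ is the least positive one, those to its right are $2,3,\dots$, and those to its left are $0,-1,\dots$. For $y_n$ the pole $x=0$ is infsupum abscissa number $0$. Branch number $b$ is the interval $[x_{n,b-1},x_{n,b})$ (left endpoint included, except that a pole is excluded; right endpoint excluded). For $c$ in the image of branch interval $b$ under $f$, $\mathrm{inverse}_b(f)(c)$ denotes the unique $x$ in branch interval $b$ with $f(x)=c$. Endpoint values $f(x_{n,b-1})$ and $f(x_{n,b})$ are interpreted as one-sided limits from inside the branch interval, possibly $\pm\infty$. *)

(* Defs.v *)
From HB Require Import structures.
From mathcomp Require Import all_boot all_order all_algebra.
From mathcomp Require Import all_classical all_reals all_analysis.

Set Implicit Arguments.
Unset Strict Implicit.
Unset Printing Implicit Defensive.

Import Order.TTheory GRing.Theory Num.Theory.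
Import numFieldNormedType.Exports.

Local Open Scope classical_set_scope.
Local Open Scope ring_scope.

(* A polynomial p : {poly int} encodes the Laurent polynomial p(1/x), so
   p`_i is the coefficient of x^-i; it is strict when there is no x^0 term. *)
Definition strict_laurent (p : {poly int}) : Prop := p`_0 = 0.

Definition laurent_eval (R : realType) (p : {poly int}) (x : R) : R :=
  (map_poly intr p).[x^-1].

(* y_n(x) = - (-x)^n (1/x d/dx)^n (cos x / x); meaningful for x != 0 only. *)
Definition sph_bessel_y (R : realType) (n : nat) (x : R) : R :=
  - (- x) ^+ n
  * iter n (fun (g : R -> R) t => t^-1 * derive1 g t) (fun t => cos t / t) x.

(* Partial functions are represented by a total function f together with
   its domain D. *)
Section Branches.
Context {R : realType} (D : set R) (f : R -> R).

Definition continuous_monotonic_on (I : set R) : Prop :=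
  [/\ is_interval I, I `<=` D, {within I, continuous f} &
      {in I &, {homo f : x y / x <= y}} \/ {in I &, {homo f : x y /~ x <= y}}].

Definition max_monotonic_interval (I : set R) : Prop :=
  continuous_monotonic_on I /\
  forall J : set R, continuous_monotonic_on J -> I `<=` J -> J = I.

(* Finite endpoints of the maximal intervals, whether or not they belong to
   them; in particular poles are included. *)
Definition infsupum_abscissas : set R :=
  [set x | exists2 I, max_monotonic_interval I &
             (has_inf I /\ x = inf I) \/ (has_sup I /\ x = sup I)].

Definition next_abscissa (a : R) : R :=
  let A := infsupum_abscissas `&` [set t | a < t] in get (A `&` lbound A).

Definition prev_abscissa (a : R) : R :=
  let A := infsupum_abscissas `&` [set t | t < a] in get (A `&` ubound A).

(* Number 1 is the least positive abscissa; one counts from it to the right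
   for m >= 1 and to the left for m <= 0. The value is unspecified when there
   is no abscissa number m. *)
Definition infsupum_abscissa (m : int) : R :=
  iter `|m - 1|%N (if 1 <= m then next_abscissa else prev_abscissa)
       (next_abscissa 0).

(* Intersecting with D removes the left endpoint when it is a pole. *)
Definition branch_interval (b : int) : set R :=
  D `&` [set x | infsupum_abscissa (b - 1) <= x < infsupum_abscissa b].

(* [unique P x] is the standard "P x and every x' with P x' equals x". *)
Definition inverse_branch (b : int) (c : R) : R :=
  get [set x | unique (fun t => branch_interval b t /\ f t = c) x].

Definition branch_left_value (b : int) : \bar R :=
  lim ((f x)%:E @[x --> (infsupum_abscissa (b - 1))^'+]).

Definition branch_right_value (b : int) : \bar R :=
  lim ((f x)%:E @[x --> (infsupum_abscissa b)^'-]).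

(* As c is finite, "<=" admits the left value only when it is finite. The two
   disjuncts are the increasing and decreasing cases. *)
Definition branch_value_interval (b : int) : set R :=
  [set c | (branch_left_value b <= c%:E < branch_right_value b)%E \/
           (branch_right_value b < c%:E <= branch_left_value b)%E].

End Branches.

(* Main.v *)
Require Import Defs.
From HB Require Import structures.
From mathcomp Require Import all_boot all_order all_algebra.
From mathcomp Require Import all_classical all_reals all_analysis.
From mathcomp Require Import ring lra zify.

Set Implicit Arguments.
Unset Strict Implicit.
Unset Printing Implicit Defensive.

Import Order.TTheory GRing.Theory Num.Theory.
Import numFieldNormedType.Exports.

Local Open Scope classical_set_scope.
Local Open Scope ring_scope.

(** The equation says y_n(x) = c0, so it must be shown that the branch intervals
cover the domain, and that y_n maps branch b bijectively onto the interval
between its one-sided limits, left one included when finite.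

For the differentiable function f = y_n on x <> 0, with derivative g, an
interval of the domain is monotonic exactly when g has a constant weak sign on
it (continuous_monotonicP). Hence every abscissa other than 0 is a zero of g
(abscissa_critical). Everything then follows from four facts:
- the zeros of g are isolated, and do not accumulate at the pole 0;
- f takes both signs arbitrarily far to the right and to the left;
- f is unbounded below to the right of 0;
- g is continuous.
Isolation makes next and previous abscissas well defined as soon as the set of
abscissas is unbounded, which oscillation guarantees; 0 is an abscissa, so no
branch has the pole in its interior, and the numbered abscissas leave no gap
(abscissa_step, branches_cover). On each branch f is strictly monotonic, as its
derivative has isolated zeros, and the intermediate value theorem describes the
image (branch_image). The behaviour at the pole ensures that the limit there is
infinite, so that it is never a value to be attained.

The four facts about y_n come from u_n, the n-th iterate of x^-1 d/dx on sin.
These satisfy u_n' = x u_{n+1} and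
x^2 u_{n+2} + (2n+1) u_{n+1} + u_n = 0, and two consecutive ones never vanish
together. It follows that y_n', divided by a nonvanishing factor, is nonzero at
a or has a nonzero first or second iterated derivative there, which isolates its
zeros (sph_bessel_y'_isolated). The leading behaviour
x^(n+1) y_n -> - (2n-1)!! at 0 handles the pole, and the values of
p cos + q sin at multiples of pi, or midway between them, give the oscillation
(sph_bessel_y_oscr). *)

(** * Isolated zeros *)

Section IsolatedZeros.
Context {R : realType}.

Lemma near_neq0 (x : R) : x != 0 -> \forall y \near x, y != 0.
Proof. by move=> x0; exact: (open_nbhs_nbhs (conj (@open_neq _ 0) x0)). Qed.

(** Nothing is said about v a, so that a may be a pole of v as well as a zero. *)
Definition isolated_zero (v : R -> R) (a : R) : Prop :=
  exists2 d : R, 0 < d & forall x, x != a -> `|x - a| < d -> v x != 0.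

Lemma isolated_zeroP v a : (\forall x \near a^', v x != 0) <-> isolated_zero v a.
Proof.
split=> [/nbhs_ballP[d /= d0 Hd]|[d d0 Hd]].
  by exists d => // x xa xd; apply: Hd => //; rewrite /ball/= distrC.
by apply/nbhs_ballP; exists d => //= x; rewrite /ball/= distrC => xd xa; exact: Hd.
Qed.

Lemma isolated_zero_cont v a : {for a, continuous v} -> v a != 0 -> isolated_zero v a.
Proof.
move=> vc va; apply/isolated_zeroP/nbhs_dnbhs.
exact: (@cvgr_neq0 _ _ _ _ _ _ _ vc va).
Qed.

(** If v a is not zero, continuity suffices. If v a = 0, every further zero of v
near a forces, by Rolle, a zero of the derivative strictly between it and a. *)
Lemma isolated_zero_deriv (v w : R -> R) (a e : R) : 0 < e ->
  (forall x : R, `|x - a| < e -> is_derive x 1 v (w x)) ->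
  isolated_zero w a -> isolated_zero v a.
Proof.
move=> e0 dv [d d0 Hd].
have vc (x : R) : `|x - a| < e -> {for x, continuous v}.
  move=> /dv dvx; apply: differentiable_continuous.
  by apply/derivable1_diffP; case: dvx.
have [va|va] := eqVneq (v a) 0; last first.
  by apply: isolated_zero_cont => //; apply: vc; rewrite subrr normr0.
exists (Num.min d e); first by rewrite lt_min d0.
move=> x xa; rewrite lt_min => /andP[xd xe]; apply/eqP => vx.
have mvt l r : l < r -> (forall z, l <= z <= r -> `|z - a| < e) -> v l = 0 -> v r = 0 ->
    exists2 z, l < z < r & w z = 0.
  move=> lr lre vl vr; have [z||z zlr] := @MVT _ v w _ _ lr.
  - by rewrite in_itv/= => /andP[? ?]; apply/dv/lre; rewrite !ltW.
  - by apply: continuous_in_subspaceT => z; rewrite inE/= in_itv/= => /lre/vc.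
  rewrite vl vr subrr => /esym/eqP; rewrite mulf_eq0 (gt_eqF (_ : 0 < r - l)) ?subr_gt0//.
  by rewrite orbF => /eqP wz; exists z; rewrite // in_itv in zlr.
move: xe xd; rewrite !ltr_norml => /andP[? ?] /andP[? ?].
case: (ltgtP x a) xa => // [xlt|xgt] _.
  have [z|//|//|z /andP[xz za] wz] := mvt x a xlt.
    by move=> /andP[? ?]; rewrite ltr_norml; apply/andP; split; lra.
  have /eqP := wz; apply/negP/Hd; first by rewrite lt_eqF.
  by rewrite ltr_norml; apply/andP; split; lra.
have [z|//|//|z /andP[az zx] wz] := mvt a x xgt.
  by move=> /andP[? ?]; rewrite ltr_norml; apply/andP; split; lra.
have /eqP := wz; apply/negP/Hd; first by rewrite gt_eqF.
by rewrite ltr_norml; apply/andP; split; lra.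
Qed.

Lemma isolated_zero_mulx v a : a != 0 -> isolated_zero v a ->
  isolated_zero (fun x => x * v x) a.
Proof.
move=> a0 /isolated_zeroP va; apply/isolated_zeroP; near=> x.
rewrite mulf_neq0//; first by near: x; apply: nbhs_dnbhs; exact: near_neq0.
by near: x.
Unshelve. all: by end_near. Qed.

End IsolatedZeros.

(** * The image of an increasing branch *)

Section Branch.
(** Here h is increasing on one branch [l, r) and l may be the pole 0, in which
case h must be unbounded below; the decreasing case is recovered from - h. *)
Context {R : realType} (h : R -> R) (l r : R).
Let A : set R := [set x | x != 0] `&` [set x | l <= x < r].
Context (lr : l < r) (gap : ~~ (l < 0 < r))
  (h_incr : forall x y, A x -> A y -> x < y -> h x < h y)
  (h_cont : forall x, x != 0 -> {for x, continuous h})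
  (h_pole : l = 0 -> forall c, exists2 x, A x & h x < c).

Let inner x : l < x -> x < r -> A x.
Proof.
move=> lx xr; split; last by rewrite /= xr ltW.
by apply: contraNneq gap => x0; rewrite -x0 lx.
Qed.

Let h_nondecr x y : A x -> A y -> x <= y -> h x <= h y.
Proof.
by move=> Ax Ay; rewrite le_eqVlt => /predU1P[->//|/(h_incr Ax Ay)/ltW].
Qed.

Lemma increasing_branch_left :
  (h x)%:E @[x --> l^'+] --> ereal_inf [set (h x)%:E | x in [set x | l < x < r]].
Proof.
have -> : [set x | l < x < r] = [set` `]l, r[%R].
  by apply/seteqP; split=> x /=; rewrite in_itv.
apply: (nondecreasing_at_right_cvge (BLeft r)); first by rewrite bnd_simp.
move=> x y; rewrite !in_itv/= => /andP[? ?] /andP[? ?] xy.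
by rewrite lee_fin; apply: h_nondecr => //; exact: inner.
Qed.

Lemma increasing_branch_right :
  (h x)%:E @[x --> r^'-] --> ereal_sup [set (h x)%:E | x in [set x | l < x < r]].
Proof.
have -> : [set (h x)%:E | x in [set x | l < x < r]] =
    [set (h (- x))%:E | x in [set` `]- r, - l[%R]].
  apply/seteqP; split=> _ [x /= lxr <-].
    by exists (- x); rewrite ?opprK// in_itv/= !ltrN2 andbC.
  by exists (- x) => //; move: lxr; rewrite in_itv/= ltrNr ltrNl andbC.
apply/cvg_at_leftNP.
apply: (nonincreasing_at_right_cvge (BLeft (- l))); first by rewrite bnd_simp ltrN2.
move=> x y; rewrite !in_itv/= => /andP[? ?] /andP[? ?] xy.
by rewrite lee_fin; apply: h_nondecr; rewrite ?lerN2//; apply: inner; lra.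
Qed.

(** When the left endpoint is not a pole, the left limit is the value there, so
it is attained. At a pole the limit is -oo and there is nothing to attain. The
right limit is a supremum that strict monotonicity keeps out of reach. The
intermediate value theorem does the rest. *)
Lemma increasing_branch_image c : (exists2 x, A x & h x = c) <->
  (lim ((h x)%:E @[x --> l^'+]) <= c%:E < lim ((h x)%:E @[x --> r^'-]))%E.
Proof.
have Linf := cvg_lim (@ereal_hausdorff R) increasing_branch_left.
have Rsup := cvg_lim (@ereal_hausdorff R) increasing_branch_right.
have left_end : l != 0 -> lim ((h x)%:E @[x --> l^'+]) = (h l)%:E.
  move=> l0; apply: cvg_lim => //; apply: cvg_at_right_filter.
  by apply: cvg_EFin; [exact: nearW|exact: h_cont].
split => [[x [x0 /= /andP[lx xr]] <-]|/andP[Lc cR]].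
  have Ax : A x by split; rewrite //= lx.
  apply/andP; split.
    have [lex|ltx] := eqVneq l x; first by rewrite left_end ?lex.
    rewrite Linf; apply: ereal_inf_lbound.
    by exists x => //=; rewrite xr lt_neqAle ltx lx.
  rewrite Rsup.
  have xm : x < (x + r) / 2 by lra.
  have Am : A ((x + r) / 2) by apply: inner; lra.
  apply: (@lt_le_trans _ _ (h ((x + r) / 2))%:E).
    by rewrite lte_fin; exact: h_incr.
  by apply: ereal_sup_ubound; exists ((x + r) / 2) => //=; apply/andP; split; lra.
have [s As sc] : exists2 s, A s & h s <= c.
  have [l0|l0] := eqVneq l 0.
    by have [s As /ltW sc] := h_pole l0 c; exists s.
  exists l; first by split=> //=; rewrite lexx.
  by rewrite -lee_fin -left_end.
move: cR; rewrite Rsup => /ereal_sup_gt[_ [t /= /andP[lt tr] <-]].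
rewrite lte_fin => ct; have At := inner lt tr.
have st : s <= t.
  by rewrite leNgt; apply/negP => ts; have := h_incr At As ts; lra.
have Ast z : s <= z <= t -> A z.
  case: As => s0 /= /andP[ls sr] /andP[sz zt].
  have [->//|/eqP zs] := eqVneq z s; first by split => //=; rewrite ls.
  apply: inner; last exact: le_lt_trans zt tr.
  by apply: (le_lt_trans ls); rewrite lt_neqAle sz eq_sym andbT; apply/eqP.
have [||z] := @IVT _ h s t c st.
- apply: continuous_in_subspaceT => z; rewrite inE/= in_itv/= => /Ast[z0 _].
  exact: h_cont.
- by rewrite ge_min sc/= le_max (ltW ct) orbT.
by rewrite in_itv/= => /Ast Az hz; exists z.
Qed.

End Branch.

(** * Abscissas and branches of a function with a pole at 0 *)

Section Structure.
Context {R : realType} (f g : R -> R).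
Let D : set R := [set x | x != 0].
Context (df : forall x : R, x != 0 -> is_derive x 1 f (g x))
  (g_cont : forall x : R, x != 0 -> {for x, continuous g})
  (g_isol : forall a : R, isolated_zero g a).

Definition weak_sign (I : set R) :=
  (forall x, I x -> 0 <= g x) \/ (forall x, I x -> g x <= 0).

Lemma f_cont x : x != 0 -> {for x, continuous f}.
Proof.
move=> /df dfx; apply: differentiable_continuous.
by apply/derivable1_diffP; case: dfx.
Qed.

Lemma mvt_on_interval (I : set R) x y :
  is_interval I -> I `<=` D -> I x -> I y -> x < y ->
  exists z, [/\ x < z, z < y, I z & f y - f x = g z * (y - x)].
Proof.
move=> Ii ID Ix Iy xy.
have IDz z : x <= z <= y -> I z by exact: (Ii x y).
have [z||z zxy ->] := @MVT _ f g x y xy.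
- rewrite in_itv/= => /andP[? ?]; apply: df; apply: ID; apply: IDz.
  by rewrite !ltW.
- apply: continuous_in_subspaceT => z; rewrite inE/= in_itv/= => zxy.
  by apply: f_cont; apply: ID; exact: IDz.
exists z; move: zxy; rewrite in_itv/= => /andP[xz zy]; split=> //.
by apply: IDz; rewrite !ltW.
Qed.

Lemma sign_near x : x != 0 -> g x != 0 -> exists2 e : R, 0 < e &
  forall y, `|y - x| < e -> y != 0 /\ 0 < g y * g x.
Proof.
move=> x0 gx0.
have [e e0 He] : exists2 e : R, 0 < e & forall y, `|y - x| < e -> `|g y - g x| < `|g x|.
  have /cvgrPdist_lt/(_ `|g x|) := g_cont x0.
  rewrite normr_gt0 => /(_ gx0)/nbhs_ballP[e /= e0 He]; exists e => // y xy.
  by rewrite distrC; apply: He; rewrite /ball/= distrC.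
exists (Num.min e `|x|); first by rewrite lt_min e0 normr_gt0.
move=> y; rewrite lt_min => /andP[ye yx]; split.
  by apply: contraTneq yx => ->; rewrite sub0r normrN ltxx.
have := He _ ye; case: (ltrgt0P (g x)) gx0 => // gx _; rewrite ltr_norml => /andP[? ?].
  by apply: mulr_gt0 => //; lra.
by rewrite nmulr_lgt0 //; lra.
Qed.

(** The mean value theorem turns the order-theoretic definition of a branch into
a sign condition on the derivative, under which intervals can be glued. *)
Lemma continuous_monotonicP (I : set R) : continuous_monotonic_on D f I <->
  [/\ is_interval I, I `<=` D & weak_sign I].
Proof.
split; last first.
  case=> Ii ID sgn; split => //.
    by apply: continuous_in_subspaceT => x; rewrite inE => /ID /f_cont.
  have le u v : u <= v -> I u -> I v -> exists2 z, I z & f v - f u = g z * (v - u).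
    rewrite le_eqVlt => /predU1P[<- Iu _|uv Iu Iv].
      by exists u; rewrite // !subrr mulr0.
    by have [z [_ _ Iz e]] := mvt_on_interval Ii ID Iu Iv uv; exists z.
  case: sgn => sgn; [left|right] => x y /[!inE] Ix Iy xy.
    have [z /sgn gz e] := le _ _ xy Ix Iy.
    by rewrite -subr_ge0 e mulr_ge0// subr_ge0.
  have [z /sgn gz e] := le _ _ xy Iy Ix.
  by rewrite -subr_le0 e mulr_le0_ge0// subr_ge0.
case=> Ii ID _ mono; split => //.
(* A nonzero g x keeps its sign near x, so f varies according to that sign
   between x and any sufficiently close point of I. *)
have key x y : I x -> I y -> x != y -> g x != 0 -> exists u v,
    [/\ I u, I v, u < v & 0 < (f v - f u) * g x].
  move=> Ix Iy xy gx0; have [e e0 He] := sign_near (ID _ Ix) gx0.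
  case: (ltgtP x y) xy => // xy _.
    pose w := Num.min y (x + e / 2).
    have xw : x < w by rewrite lt_min xy/=; lra.
    have wy : w <= y by rewrite ge_min lexx.
    have wx : w <= x + e / 2 by rewrite ge_min lexx orbT.
    have Iw : I w by apply: (Ii x y) => //; rewrite ltW.
    have [z [xz zw _ fz]] := mvt_on_interval Ii ID Ix Iw xw.
    exists x, w; split=> //; rewrite fz mulrAC pmulr_lgt0 ?subr_gt0//.
    by case: (He z); rewrite // gtr0_norm ?subr_gt0//; lra.
  pose w := Num.max y (x - e / 2).
  have wx : w < x by rewrite gt_max xy/=; lra.
  have yw : y <= w by rewrite le_max lexx.
  have xew : x - e / 2 <= w by rewrite le_max lexx orbT.
  have Iw : I w by apply: (Ii y x) => //; rewrite yw ltW.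
  have [z [wz zx _ fz]] := mvt_on_interval Ii ID Iw Ix wx.
  exists w, x; split=> //; rewrite fz mulrAC pmulr_lgt0 ?subr_gt0//.
  by case: (He z); rewrite // ltr0_norm ?subr_lt0//; lra.
have [[x [y [Ix Iy xy]]]|sing] := pselect (exists x y, [/\ I x, I y & x != y]).
  have nb z : I z -> exists2 t, I t & z != t.
    move=> Iz; case: (eqVneq z x) => [->|zx]; last by exists x.
    by exists y.
  case: mono => mono; [left|right] => z Iz; have [t It zt] := nb _ Iz.
    rewrite leNgt; apply/negP => gz.
    have [|u [v [Iu Iv uv]]] := key _ _ Iz It zt; first by rewrite lt_eqF.
    rewrite nmulr_lgt0// subr_lt0 ltNge mono ?inE//; exact: ltW.
  rewrite leNgt; apply/negP => gz.
  have [|u [v [Iu Iv uv]]] := key _ _ Iz It zt; first by rewrite gt_eqF.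
  rewrite pmulr_lgt0// subr_gt0 ltNge mono ?inE//; exact: ltW.
have [[z Iz gz]|ng] := pselect (exists2 z, I z & 0 <= g z); [left|right] => x Ix.
  suff -> : x = z by [].
  by apply/eqP/negPn/negP => xz; apply: sing; exists x, z.
by rewrite leNgt; apply/negP => gx; apply: ng; exists x => //; exact: ltW.
Qed.

Lemma is_intervalU (A B : set R) c : is_interval A -> is_interval B ->
  A c -> B c -> is_interval (A `|` B).
Proof.
move=> iA iB Ac Bc x y xAB yAB z /andP[xz zy].
have [zc|cz] := lerP z c.
  by case: xAB => [Ax|Bx]; [left; apply: (iA x c)|right; apply: (iB x c)] => //;
    rewrite xz.
by case: yAB => [Ay|By]; [left; apply: (iA c y)|right; apply: (iB c y)] => //;
    rewrite zy ltW.
Qed.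

Lemma weak_sign_at (I : set R) x y : weak_sign I -> I x -> I y -> 0 <= g x * g y.
Proof.
by case=> h Ix Iy; [apply: mulr_ge0|apply: mulr_le0]; apply: h.
Qed.

(** A maximal interval through x is the union of all competing ones: as g x is
not zero, it decides the direction of monotonicity for all of them. *)
Lemma max_monotonic_exists x : x != 0 -> g x != 0 ->
  exists2 I, max_monotonic_interval D f I & I x /\
    (forall J, continuous_monotonic_on D f J -> J x -> J `<=` I).
Proof.
move=> x0 gx0.
pose M : set R := [set y | exists2 J, continuous_monotonic_on D f J & J x /\ J y].
have Mx : M x.
  exists [set x] => //; apply/continuous_monotonicP; split.
  - by move=> _ _ -> -> z; rewrite andbC => /le_anti ->.
  - by move=> _ ->.
  - by have [g0|g0] := leP 0 (g x); [left|right] => _ -> //; exact: ltW.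
have JM J : continuous_monotonic_on D f J -> J x -> J `<=` M.
  by move=> CJ Jx y Jy; exists J.
have CM : continuous_monotonic_on D f M.
  apply/continuous_monotonicP; split.
  - move=> u v [J CJ [Jx Ju]] [K CK [Kx Kv]] z zuv.
    case/continuous_monotonicP: (CJ) => iJ _ _.
    case/continuous_monotonicP: (CK) => iK _ _.
    have [Jz|Kz] := is_intervalU iJ iK Jx Kx (or_introl Ju) (or_intror Kv) zuv.
      by exists J.
    by exists K.
  - by move=> u [J /continuous_monotonicP[_ JD _] [_ /JD]].
  - case: (ltrgt0P (g x)) gx0 => // gx _; [left|right] => y
      [J /continuous_monotonicP[_ _ sJ] [Jx Jy]].
      by have := weak_sign_at sJ Jx Jy; rewrite pmulr_rge0.
    by have := weak_sign_at sJ Jx Jy; rewrite nmulr_rge0.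
exists M => //; split=> // J CJ MJ.
by apply/seteqP; split=> //; apply: JM => //; exact: MJ.
Qed.

Let E := infsupum_abscissas D f.

(** A maximal interval ending at x meets a neighbourhood of x on which g has the
sign of g x, and could be enlarged by it. *)
Lemma abscissa_critical x : x != 0 -> g x != 0 -> ~ E x.
Proof.
move=> x0 gx0 [I maxI Ex].
have [e e0 He] := sign_near x0 gx0.
pose B : set R := [set y | `|y - x| < e].
have Bx : B x by rewrite /B/= subrr normr0.
have iB : is_interval B.
  move=> u v; rewrite /B/= !ltr_distl => /andP[? ?] /andP[? ?] z /andP[? ?].
  rewrite ltr_distl.
  by apply/andP; split; lra.
have Bs y : B y -> 0 < g y * g x by move=> /He[].
have [i Ii Bi] : exists2 i, I i & B i.
  case: Ex => -[hI xI].
    have [i Ii ie] := inf_adherent e0 hI; exists i => //.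
    have := ge_inf hI.2 Ii; rewrite /B/= ltr_distl -xI => xi; rewrite -xI in ie.
    by apply/andP; split; lra.
  have [i Ii ie] := sup_adherent e0 hI; exists i => //.
  have := ub_le_sup hI.2 Ii; rewrite /B/= ltr_distl -xI => xi; rewrite -xI in ie.
  by apply/andP; split; lra.
case: maxI => /continuous_monotonicP[iI ID sI] maxI.
have CU : continuous_monotonic_on D f (I `|` B).
  apply/continuous_monotonicP; split; first exact: is_intervalU Ii Bi.
  - by move=> y [/ID//|/He[]].
  - have gi := Bs _ Bi.
    case: (ltrgt0P (g x)) gx0 => // gx _; [left|right] => y [Iy|By].
    + have := weak_sign_at sI Ii Iy; rewrite pmulr_rge0//.
      by move: gi; rewrite pmulr_lgt0.
    + by have := Bs _ By; rewrite pmulr_lgt0// => /ltW.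
    + have := weak_sign_at sI Ii Iy; rewrite nmulr_rge0//.
      by move: gi; rewrite nmulr_lgt0.
    + by have := Bs _ By; rewrite nmulr_lgt0// => /ltW.
have IU := maxI _ CU (@subsetUl _ I B).
have BI y : B y -> I y by move=> By; rewrite -IU; right.
case: Ex => -[hI xI].
  have /BI/(ge_inf hI.2) : B (x - e / 2).
    by rewrite /B/= addrC addKr normrN gtr0_norm; lra.
  by rewrite -xI; lra.
have /BI/(ub_le_sup hI.2) : B (x + e / 2).
  by rewrite /B/= addrC addKr gtr0_norm; lra.
by rewrite -xI; lra.
Qed.

Lemma abscissa_isol (a : R) : exists2 d : R, 0 < d &
  forall x, x != a -> `|x - a| < d -> ~ E x.
Proof.
have [d d0 Hd] := g_isol a.
have [->|a0] := eqVneq a 0.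
  have [d' d'0 Hd'] := g_isol 0.
  by exists d' => // x x0 xd; apply: abscissa_critical => //; exact: Hd'.
exists (Num.min d `|a|); first by rewrite lt_min d0 normr_gt0.
move=> x xa; rewrite lt_min => /andP[xd xa'].
apply: abscissa_critical; last exact: Hd.
by apply: contraTneq xa' => ->; rewrite sub0r normrN ltxx.
Qed.

(** A maximal interval through x can only stop short of y at an abscissa. *)
Lemma abscissa_between I x y : max_monotonic_interval D f I -> I x -> ~ I y ->
  exists2 e, E e & (y <= e <= x) || (x <= e <= y).
Proof.
move=> maxI Ix nIy; case: (maxI) => /continuous_monotonicP[iI _ _] _.
have [yx|xy] := ltP y x.
  have lb : lbound I y.
    move=> z Iz; rewrite leNgt; apply/negP => zy; apply: nIy.
    by apply: (iI z x) => //; rewrite !ltW.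
  have hI : has_inf I by split; [exists x|exists y].
  exists (inf I); first by exists I => //; left.
  apply/orP; left; apply/andP; split; last exact: ge_inf hI.2 _ Ix.
  by apply: lb_le_inf => //; exists x.
have ub : ubound I y.
  move=> z Iz; rewrite leNgt; apply/negP => yz; apply: nIy.
  by apply: (iI x z) => //; rewrite xy ltW.
have hI : has_sup I by split; [exists x|exists y].
exists (sup I); first by exists I => //; right.
apply/orP; right; apply/andP; split; first exact: ub_le_sup hI.2 _ Ix.
by apply: ge_sup => //; exists x.
Qed.

Lemma nonzero_between a b : a < b -> exists x, [/\ a < x, x < b, x != 0 & g x != 0].
Proof.
move=> ab; wlog ab0 : a b ab / b <= 0 \/ 0 <= a.
  move=> W; have [b0|b0] := leP b 0; first by apply: W => //; left.
  have [a0|a0] := leP 0 a; first by apply: W => //; right.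
  have [|x [? ? ? ?]] := W _ _ a0; first by left.
  by exists x; split=> //; lra.
have [d d0 Hd] := g_isol a.
pose x := Num.min (a + d / 2) ((a + b) / 2).
have ax : a < x by rewrite lt_min; apply/andP; split; lra.
have xd : x <= a + d / 2 by rewrite ge_min lexx.
have xb : x <= (a + b) / 2 by rewrite ge_min lexx orbT.
exists x; split => //; first by lra.
- by case: ab0 => ?; [rewrite lt_eqF//; lra|rewrite gt_eqF//; lra].
- by apply: Hd; [rewrite gt_eqF|rewrite gtr0_norm; lra].
Qed.

(** Close to 0 only 0 can be an abscissa, and a maximal interval through a small
positive point must end at one, as it cannot contain 0. *)
Lemma abscissa0 : E 0.
Proof.
have [d d0 Hd] := abscissa_isol 0.
have [x [x0 xd xn0 gx0]] := nonzero_between d0.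
have [I maxI [Ix _]] := max_monotonic_exists xn0 gx0.
have [|e Ee] := abscissa_between (y := 0) maxI Ix.
  by case: maxI => /continuous_monotonicP[_ ID _] _ /ID; rewrite /D/= eqxx.
move=> e0x; have [<-//|en0] := eqVneq e 0.
have : `|e - 0| < d.
  rewrite subr0 ltr_norml.
  by case/orP: e0x => /andP[? ?]; apply/andP; split; lra.
by move=> /(Hd _ en0).
Qed.

Lemma weak_sign_gap l r : l < r -> (forall e, E e -> ~~ (l < e < r)) ->
  weak_sign [set x | l < x < r].
Proof.
move=> lr gap; have [x [lx xr x0 gx0]] := nonzero_between lr.
have [I maxI [Ix _]] := max_monotonic_exists x0 gx0.
have sub y : l < y < r -> I y.
  move=> /andP[ly yr]; apply: contrapT => nIy.
  have [e Ee eyx] := abscissa_between maxI Ix nIy.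
  have /negP := gap _ Ee; apply.
  by case/orP: eyx => /andP[? ?]; apply/andP; split; lra.
by case: maxI => /continuous_monotonicP[_ _ [s|s]] _; [left|right] => y /sub/s.
Qed.

Context (f_pole : forall c d : R, 0 < d -> exists x, [/\ 0 < x, x < d & f x < c])
  (f_oscr : forall M : R,
     (exists2 x, M < x & 0 < f x) /\ (exists2 x, M < x & f x < 0))
  (f_oscl : forall M : R,
     (exists2 x, x < M & 0 < f x) /\ (exists2 x, x < M & f x < 0)).

(** Beyond the last abscissa f would be monotonic, hence of constant sign from
some point on. *)
Lemma abscissa_gt (M : R) : exists2 e, E e & M < e.
Proof.
apply: contrapT => nE; pose M' := Num.max M 0.
have M'0 : 0 <= M' by rewrite le_max lexx orbT.
have MM' : M <= M' by rewrite le_max lexx.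
have [|x [M'x _ x0 gx0]] := @nonzero_between M' (M' + 1); first lra.
have [I maxI [Ix _]] := max_monotonic_exists x0 gx0.
have sub y : M' < y -> I y.
  move=> M'y; apply: contrapT => nIy.
  have [e Ee eyx] := abscissa_between maxI Ix nIy.
  by apply: nE; exists e => //; case/orP: eyx => /andP[? ?]; lra.
case: maxI => /continuous_monotonicP[iI ID [s|s]] _.
  have [[u M'u fu] _] := f_oscr M'; have [_ [v uv fv]] := f_oscr u.
  have [||z [_ _ /s gz e]] := mvt_on_interval iI ID _ _ uv; [exact: sub|apply: sub; lra|].
  suff : 0 <= f v - f u by lra.
  by rewrite e mulr_ge0//; lra.
have [_ [u M'u fu]] := f_oscr M'; have [[v uv fv] _] := f_oscr u.
have [||z [_ _ /s gz e]] := mvt_on_interval iI ID _ _ uv; [exact: sub|apply: sub; lra|].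
suff : f v - f u <= 0 by lra.
by rewrite e mulr_le0_ge0//; lra.
Qed.

Lemma abscissa_lt (M : R) : exists2 e, E e & e < M.
Proof.
apply: contrapT => nE; pose M' := Num.min M 0.
have M'0 : M' <= 0 by rewrite ge_min lexx orbT.
have MM' : M' <= M by rewrite ge_min lexx.
have [|x [_ M'x x0 gx0]] := @nonzero_between (M' - 1) M'; first lra.
have [I maxI [Ix _]] := max_monotonic_exists x0 gx0.
have sub y : y < M' -> I y.
  move=> M'y; apply: contrapT => nIy.
  have [e Ee eyx] := abscissa_between maxI Ix nIy.
  by apply: nE; exists e => //; case/orP: eyx => /andP[? ?]; lra.
case: maxI => /continuous_monotonicP[iI ID [s|s]] _.
  have [_ [u M'u fu]] := f_oscl M'; have [[v uv fv] _] := f_oscl u.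
  have [||z [_ _ /s gz e]] := mvt_on_interval iI ID _ _ uv; [apply: sub; lra|exact: sub|].
  suff : 0 <= f u - f v by lra.
  by rewrite e mulr_ge0//; lra.
have [[u M'u fu] _] := f_oscl M'; have [_ [v uv fv]] := f_oscl u.
have [||z [_ _ /s gz e]] := mvt_on_interval iI ID _ _ uv; [apply: sub; lra|exact: sub|].
suff : f u - f v <= 0 by lra.
by rewrite e mulr_le0_ge0//; lra.
Qed.

(** The infimum of the abscissas to the right of a is one of them, because
abscissas are isolated. *)
Lemma next_abscissaP (a : R) : [/\ E (next_abscissa D f a),
  a < next_abscissa D f a & forall e, E e -> a < e -> next_abscissa D f a <= e].
Proof.
pose A := E `&` [set t | a < t].
suff [m [[Em am] lm]] : exists m, (A `&` lbound A) m.
  have [[En an] ln] : (A `&` lbound A) (next_abscissa D f a).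
    by apply: getPex; exists m.
  by split=> // e Ee ae; apply: ln.
have [e0 Ee0 ae0] := abscissa_gt a.
have hA : has_inf A.
  by split; [exists e0|exists a => t [_ /= /ltW]].
exists (inf A); split; last exact: ge_inf hA.2.
have [d d0 Hd] := abscissa_isol (inf A).
have [i [Ei ai] id] := inf_adherent d0 hA.
have infi : inf A <= i by exact: (ge_inf hA.2).
have [<-//|ne] := eqVneq i (inf A).
by case: (Hd _ ne) => //; rewrite ger0_norm; lra.
Qed.

Lemma prev_abscissaP (a : R) : [/\ E (prev_abscissa D f a),
  prev_abscissa D f a < a & forall e, E e -> e < a -> e <= prev_abscissa D f a].
Proof.
pose A := E `&` [set t | t < a].
suff [m [[Em am] lm]] : exists m, (A `&` ubound A) m.
  have [[En an] ln] : (A `&` ubound A) (prev_abscissa D f a).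
    by apply: getPex; exists m.
  by split=> // e Ee ae; apply: ln.
have [e0 Ee0 ae0] := abscissa_lt a.
have hA : has_sup A.
  by split; [exists e0|exists a => t [_ /= /ltW]].
exists (sup A); split; last exact: ub_le_sup hA.2.
have [d d0 Hd] := abscissa_isol (sup A).
have [i [Ei ai] id] := sup_adherent d0 hA.
have infi : i <= sup A by exact: (ub_le_sup hA.2).
have [<-//|ne] := eqVneq i (sup A).
by case: (Hd _ ne) => //; rewrite ler0_norm; lra.
Qed.

Let X := infsupum_abscissa D f.

Lemma abscissa_right (k : nat) : X (1 + k%:Z) = iter k (next_abscissa D f) (X 1).
Proof.
rewrite /X /infsupum_abscissa.
have -> : `|(1 + k%:Z - 1)%R|%N = k by lia.
by have -> : (1 <= 1 + k%:Z) = true by lia.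
Qed.

Lemma abscissa_left (k : nat) : X (1 - k%:Z) = iter k (prev_abscissa D f) (X 1).
Proof.
case: k => [|k]; first by rewrite subr0.
rewrite /X /infsupum_abscissa.
have -> : `|(1 - k.+1%:Z - 1)%R|%N = k.+1 by lia.
by have -> : (1 <= 1 - k.+1%:Z) = false by lia.
Qed.

Definition consecutive_abscissas (l r : R) :=
  [/\ E l, E r, l < r & forall e, E e -> ~~ (l < e < r)].

Lemma consecutive_next a : E a -> consecutive_abscissas a (next_abscissa D f a).
Proof.
move=> Ea; have [En an h] := next_abscissaP a; split=> [//|//|//|e Ee].
by apply/negP => /andP[/(h _ Ee)]; lra.
Qed.

Lemma consecutive_prev a : E a -> consecutive_abscissas (prev_abscissa D f a) a.
Proof.
move=> Ea; have [En an h] := prev_abscissaP a; split=> [//|//|//|e Ee].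
by apply/negP => /andP[ae /(h _ Ee)]; lra.
Qed.

Lemma abscissa_step (b : int) : consecutive_abscissas (X (b - 1)) (X b).
Proof.
have E1 : E (X 1) by case: (next_abscissaP 0).
have Er k : E (iter k (next_abscissa D f) (X 1)).
  by elim: k => [//|k IH]; case: (consecutive_next IH).
have El k : E (iter k (prev_abscissa D f) (X 1)).
  by elim: k => [//|k IH]; case: (consecutive_prev IH).
have [b1|b1] := lerP b 1.
  have [k ->] : exists k : nat, b = 1 - k%:Z by exists `|(1 - b)%R|%N; lia.
  have -> : 1 - k%:Z - 1 = 1 - k.+1%:Z by lia.
  rewrite (abscissa_left k) (abscissa_left k.+1) iterS; exact: consecutive_prev.
have [k ->] : exists k : nat, b = 1 + k.+1%:Z by exists `|(b - 2)%R|%N; lia.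
have -> : 1 + k.+1%:Z - 1 = 1 + k%:Z by lia.
rewrite (abscissa_right k) (abscissa_right k.+1) iterS; exact: consecutive_next.
Qed.

(** Otherwise the numbered abscissas would accumulate at their supremum or
infimum. *)
Lemma abscissa_unbounded (x : R) : (exists b, x < X b) /\ (exists b, X b <= x).
Proof.
split; apply: contrapT => nb.
  pose A : set R := range X.
  have ub : ubound A x.
    by move=> _ [b _ <-]; rewrite leNgt; apply/negP => xb; apply: nb; exists b.
  have hA : has_sup A by split; [exists (X 0); exists 0|exists x].
  have [d d0 Hd] := abscissa_isol (sup A).
  have [_ [b _ <-] bd] := sup_adherent d0 hA.
  have := abscissa_step (b + 1); rewrite addrK => -[Eb _ lt _].
  have ltA : X b < sup A.
    by apply: (lt_le_trans lt); apply: (ub_le_sup hA.2); exists (b + 1).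
  by apply: (Hd (X b)) => //; [rewrite lt_eqF|rewrite ltr0_norm; lra].
pose A : set R := range X.
have ub : lbound A x.
  move=> _ [b _ <-]; rewrite leNgt; apply/negP => xb; apply: nb; exists b; exact: ltW.
have hA : has_inf A by split; [exists (X 0); exists 0|exists x].
have [d d0 Hd] := abscissa_isol (inf A).
have [_ [b _ <-] bd] := inf_adherent d0 hA.
have [_ Eb lt _] := abscissa_step b.
have ltA : inf A < X b by apply: le_lt_trans lt; apply: (ge_inf hA.2); exists (b - 1).
by apply: (Hd (X b)) => //; [rewrite gt_eqF|rewrite gtr0_norm; lra].
Qed.

Lemma branches_cover (x : R) : exists b : int, X (b - 1) <= x < X b.
Proof.
have [[b xb] [a ax]] := abscissa_unbounded x.
have mono c d : c <= d -> X c <= X d.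
  move=> cd; have -> : d = c + `|(d - c)%R|%N%:Z by lia.
  elim: `|_|%N => [|k IH]; first by rewrite addr0.
  apply: (le_trans IH); have [_ _ lt _] := abscissa_step (c + k.+1%:Z).
  by apply: le_trans (ltW lt); have -> : c + k.+1%:Z - 1 = c + k%:Z by lia.
have ab : a <= b by rewrite leNgt; apply/negP => /ltW/mono; lra.
have ex : exists k : nat, x < X (a + k%:Z).
  by exists `|(b - a)%R|%N; have -> : a + `|(b - a)%R|%N%:Z = b by lia.
case: (ex_minnP ex) => -[|k] xk mink; first by rewrite addr0 in xk; lra.
exists (a + k.+1%:Z); rewrite xk andbT.
have -> : a + k.+1%:Z - 1 = a + k%:Z by lia.
by rewrite leNgt; apply/negP => /mink; rewrite ltnn.
Qed.

Let branch_gap b : ~~ (X (b - 1) < 0 < X b).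
Proof. by have [_ _ _] := abscissa_step b; apply; exact: abscissa0. Qed.

(** The sign s = 1 or -1 treats both directions of monotonicity at once. Weak
monotonicity comes from the mean value theorem; it is strict because g has no
zero just to the right of x. *)
Lemma branch_strict (s : R) b :
  (forall x, X (b - 1) < x < X b -> 0 <= s * g x) -> s != 0 ->
  forall x y, branch_interval D f b x -> branch_interval D f b y -> x < y ->
  0 < s * (f y - f x).
Proof.
move=> sg s0 x y [/= x0 /andP[lx xr]] [/= y0 /andP[ly yr]] xy.
rewrite -/X in lx xr ly yr.
have [_ _ lr _] := abscissa_step b.
pose I : set R := [set z | x <= z < X b].
have iI : is_interval I.
  by move=> u v /andP[? ?] /andP[? ?] z /andP[? ?]; apply/andP; split; lra.
have ID : I `<=` D.
  move=> z /andP[xz zr]; apply: contraNneq (branch_gap b) => z0; rewrite -z0 zr andbT.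
  by rewrite (le_lt_trans lx)// lt_neqAle xz z0 x0.
have Ix : I x by rewrite /I/= lexx.
have Iy : I y by rewrite /I/= yr ltW.
have [d d0 Hd] := g_isol x.
pose w := Num.min y (x + d / 2).
have xw : x < w by rewrite lt_min xy/=; lra.
have wy : w <= y by rewrite ge_min lexx.
have wd : w <= x + d / 2 by rewrite ge_min lexx orbT.
have Iw : I w by apply/andP; split; lra.
have -> : f y - f x = (f y - f w) + (f w - f x) by rewrite addrA subrK.
rewrite mulrDr; apply: ltr_wpDl.
  have [->|wny] := eqVneq w y; first by rewrite subrr mulr0.
  have [|z [wz zy _ ->]] := mvt_on_interval iI ID Iw Iy; first by rewrite lt_neqAle wny.
  by rewrite mulrA mulr_ge0 ?sg//; [apply/andP; split; lra|lra].
have [z [xz zw Iz ->]] := mvt_on_interval iI ID Ix Iw xw.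
rewrite mulrA mulr_gt0 ?subr_gt0// lt_neqAle sg ?andbT; last by apply/andP; split; lra.
by rewrite eq_sym mulf_neq0// Hd ?gt_eqF// gtr0_norm; lra.
Qed.

(** A decreasing branch is the negative of an increasing one. It cannot start at
the pole, because f is unbounded below just to the right of 0. *)
Lemma branch_image b c :
  (forall x y, branch_interval D f b x -> branch_interval D f b y ->
     f x = f y -> x = y) /\
  ((exists2 x, branch_interval D f b x & f x = c) <-> branch_value_interval D f b c).
Proof.
have [_ _ lr gap] := abscissa_step b.
pose m := (X (b - 1) + X b) / 2.
have lm : X (b - 1) < m by rewrite /m; lra.
have mr : m < X b by rewrite /m; lra.
have inA x : X (b - 1) < x -> x < X b -> branch_interval D f b x.
  move=> lx xr; split=> /=; last by rewrite xr ltW.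
  by apply: contraNneq (branch_gap b) => x0; rewrite -x0 lx.
have Am := inA _ lm mr.
have inj s : s != 0 -> (forall x y, branch_interval D f b x ->
    branch_interval D f b y -> x < y -> 0 < s * (f y - f x)) ->
  forall x y, branch_interval D f b x -> branch_interval D f b y ->
    f x = f y -> x = y.
  move=> s0 mono x y Ax Ay fxy.
  by case: (ltgtP x y) => // [/(mono _ _ Ax Ay)|/(mono _ _ Ay Ax)];
    rewrite fxy subrr mulr0 ltxx.
rewrite /branch_value_interval /= /branch_left_value /branch_right_value -/X.
case: (weak_sign_gap lr gap) => sg.
  have mono : forall x y, branch_interval D f b x -> branch_interval D f b y ->
      x < y -> f x < f y.
    move=> x y Ax Ay xy; rewrite -subr_gt0 -[f y - f x]mul1r.
    by apply: (@branch_strict 1 b); rewrite ?oner_eq0// => z ?; rewrite mul1r sg.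
  split.
    apply: (inj 1); rewrite ?oner_eq0// => x y Ax Ay xy.
    by rewrite mul1r subr_gt0 mono.
  have img := @increasing_branch_image R f _ _ lr (branch_gap b) mono f_cont _.
  have pole : X (b - 1) = 0 ->
      forall c, exists2 x, branch_interval D f b x & f x < c.
    move=> l0 c'; have [|x [x0 xr fx]] := @f_pole c' (X b); first by rewrite -l0.
    by exists x => //; apply: inA; rewrite ?l0.
  apply: iff_trans (img pole c) _; split=> [|[//|/andP[Rc cL]]]; first by left.
  have /andP[Lm mR] : (lim ((f x)%:E @[x --> (X (b - 1))^'+]) <= (f m)%:E <
      lim ((f x)%:E @[x --> (X b)^'-]))%E.
    by apply/(img pole); exists m.
  have := lt_le_trans (lt_le_trans Rc cL) (le_trans Lm (ltW mR)).
  by rewrite ltxx.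
have mono : forall x y, branch_interval D f b x -> branch_interval D f b y ->
    x < y -> - f x < - f y.
  move=> x y Ax Ay xy; rewrite -subr_gt0 -opprD -mulN1r.
  by apply: (@branch_strict (-1) b); rewrite ?oppr_eq0 ?oner_eq0// => z ?;
    rewrite mulN1r oppr_ge0 sg.
split.
  apply: (inj (-1)); rewrite ?oppr_eq0 ?oner_eq0// => x y Ax Ay xy.
  by rewrite mulN1r opprD subr_gt0 mono.
have fNc x : x != 0 -> {for x, continuous (fun x => - f x)}.
  by move=> x0; apply: cvgN; exact: f_cont.
have img := @increasing_branch_image R (fun x => - f x) _ _ lr (branch_gap b) mono fNc _.
have pole : X (b - 1) = 0 ->
    forall c, exists2 x, branch_interval D f b x & - f x < c.
  move=> l0; have m0 : 0 < m by rewrite -l0.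
  have [x [x0 xm fx]] := f_pole (f m) m0.
  have Ax : branch_interval D f b x by apply: inA; rewrite ?l0//; exact: lt_trans mr.
  by have := mono _ _ Ax Am xm; lra.
have limN F : Filter F -> forall u, ((- f x)%:E @[x --> F] --> u)%E ->
    ((f x)%:E @[x --> F] --> - u)%E.
  move=> FF u /cvgeN.
  by under eq_fun do rewrite -EFinN opprK.
have lE := increasing_branch_left lr (branch_gap b) mono.
have rE := increasing_branch_right lr (branch_gap b) mono.
rewrite (cvg_lim (@ereal_hausdorff R) lE) (cvg_lim (@ereal_hausdorff R) rE) in img.
rewrite (cvg_lim (@ereal_hausdorff R) (limN _ _ _ lE)).
rewrite (cvg_lim (@ereal_hausdorff R) (limN _ _ _ rE)).
set L := ereal_inf _ in img lE *; set S := ereal_sup _ in img rE *.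
have imgN c' : (exists2 x, branch_interval D f b x & f x = c') <->
    (- S < c'%:E <= - L)%E.
  rewrite lteNl leeNr andbC -EFinN.
  apply: iff_trans (img pole (- c')).
  by split=> -[x Ax fx]; exists x => //; [rewrite fx|rewrite -[f x]opprK fx opprK].
apply: iff_trans (imgN c) _; split=> [|[/andP[Lc cS]|//]]; first by right.
have /andP[Sm mL] : (- S < (f m)%:E <= - L)%E by apply/imgN; exists m.
have := lt_le_trans (lt_le_trans (le_lt_trans Lc cS) (ltW Sm)) mL.
by rewrite ltxx.
Qed.

Theorem branch_inverses_solve c :
  [set x : R | x != 0 /\ f x = c] =
  [set inverse_branch D f b c | b in [set b : int | branch_value_interval D f b c]].
Proof.
have invE b x : branch_interval D f b x -> f x = c -> inverse_branch D f b c = x.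
  move=> Ax fx; have [inj _] := branch_image b c.
  apply: get_unique; first by split=> // y [Ay fy]; apply: inj; rewrite ?fx ?fy.
  by move=> y [[Ay fy] _]; apply: inj; rewrite ?fx ?fy.
apply/seteqP; split=> [x [x0 fx]|_ [b /= Bb <-]].
  have [b xb] := branches_cover x.
  have Ax : branch_interval D f b x by split.
  by exists b; [apply/(branch_image b c).2; exists x|exact: invE].
have [x Ax fx] := (branch_image b c).2.2 Bb.
by rewrite (invE _ _ Ax fx); case: Ax.
Qed.

End Structure.

(** * Iterates of x^-1 d/dx on the sine *)

(** With u_n the n-th iterate of x^-1 d/dx on sin, y_n is - (-x)^n u_{n+1}. The
shift makes sin itself the start of the three-term recurrence. *)
Definition rayleigh_iterate {R : realType} (n : nat) : R -> R :=
  iter n (fun (g : R -> R) t => t^-1 * derive1 g t) sin.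

Arguments rayleigh_iterate : simpl never.

Section Rayleigh.
Context {R : realType}.
Local Notation u := (@rayleigh_iterate R).

Lemma rayleigh0 : u 0 = sin. Proof. by []. Qed.

Lemma rayleigh1 : u 1 = (fun t => cos t / t).
Proof.
apply/funext => t; rewrite /rayleigh_iterate /= derive1E mulrC.
by rewrite (@derive_val _ _ _ _ _ _ _ (is_derive_sin t)).
Qed.

Lemma sph_bessel_yE n (x : R) : sph_bessel_y n x = - (- x) ^+ n * u n.+1 x.
Proof. by rewrite /sph_bessel_y -rayleigh1 /rayleigh_iterate [in RHS]iterSr. Qed.

Lemma rayleigh_derive1 n (x df : R) : x != 0 -> is_derive x 1 (u n) df ->
  df = x * u n.+1 x.
Proof.
move=> x0 dfx; rewrite /rayleigh_iterate iterS derive1E.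
by rewrite (@derive_val _ _ _ _ _ _ _ dfx) mulVKf.
Qed.

Lemma rayleigh_derivableP n (x : R) : x != 0 -> derivable (u n) x 1 ->
  is_derive x 1 (u n) (x * u n.+1 x).
Proof.
by move=> x0 dx; rewrite -(rayleigh_derive1 x0 (derivableP dx)); exact: derivableP.
Qed.

(** A three-term recurrence between a function and its first two iterates shows
that the second iterate is differentiable too; differentiating the recurrence
and dividing by x shifts it by one. *)
Lemma three_term_shift (a : R) (U0 U1 U2 U3 : R -> R) :
    (forall x : R, x != 0 -> is_derive x 1 U0 (x * U1 x)) ->
    (forall x : R, x != 0 -> is_derive x 1 U1 (x * U2 x)) ->
    (forall x : R, x != 0 -> derivable U2 x 1 -> is_derive x 1 U2 (x * U3 x)) ->
    (forall x : R, x != 0 -> x ^+ 2 * U2 x = - (a * U1 x + U0 x)) ->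
  forall x : R, x != 0 -> is_derive x 1 U2 (x * U3 x) /\
    x ^+ 2 * U3 x = - ((a + 2) * U2 x + U1 x).
Proof.
move=> d0 d1 d2 rec x x0.
have sq : is_derive x 1 (fun y : R => y ^+ 2) (2 * x).
  by apply: is_derive_eq; rewrite /GRing.scale /= mulr1; ring.
have dF : is_derive x 1 (fun y => - (a * U1 y + U0 y)) (- (a * (x * U2 x) + x * U1 x)).
  have i0 := d0 _ x0; have i1 := d1 _ x0.
  exact: (is_deriveN (is_deriveD (is_deriveZ a i1) i0)).
have dU2 : derivable U2 x 1.
  apply: (@near_eq_derivable _ _ _ (fun y => - (a * U1 y + U0 y) * (y ^+ 2)^-1)).
    near=> y; have y0 : y != 0 by near: y; exact: near_neq0.
    by rewrite -rec// mulrC mulKf// expf_neq0.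
  apply: derivableM; first by case: dF.
  by apply: derivableV; [rewrite expf_neq0|case: sq].
have i2 := d2 _ x0 dU2; split=> //.
have dG := is_deriveM sq i2.
have dF' : is_derive x 1 (fun y => y ^+ 2 * U2 y) (- (a * (x * U2 x) + x * U1 x)).
  apply: near_eq_is_derive dF.
  by near=> y; rewrite -rec//; near: y; exact: near_neq0.
have := @derive_val _ _ _ _ _ _ _ dG.
rewrite (@derive_val _ _ _ _ _ _ _ dF') /GRing.scale /= => e.
apply: (mulfI x0).
transitivity (x ^+ 2 * (x * U3 x) + U2 x * (2 * x) - U2 x * (2 * x)); first ring.
by rewrite -e; ring.
Unshelve. all: by end_near. Qed.

Lemma rayleigh_derive_rec n (x : R) : x != 0 ->
  [/\ is_derive x 1 (u n) (x * u n.+1 x), is_derive x 1 (u n.+1) (x * u n.+2 x) &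
      x ^+ 2 * u n.+2 x = - (n.*2.+1%:R * u n.+1 x + u n x)].
Proof.
elim: n x => [|n IH] x x0.
  have du0 : derivable (u 0) x 1 by case: (is_derive_sin x).
  have i1 : is_derive x 1 (u 1) (- sin x / x - cos x / x ^+ 2).
    rewrite rayleigh1; apply: is_derive_eq.
      by apply: is_deriveM; exact: is_deriveV.
    by rewrite /= /GRing.scale /=; field.
  split; first exact: rayleigh_derivableP.
    by apply: (rayleigh_derivableP x0); case: i1.
  rewrite expr2 -mulrA -(rayleigh_derive1 x0 i1) rayleigh1 /= double0 mul1r.
  by rewrite rayleigh0; field.
have d0 (y : R) : y != 0 -> is_derive y 1 (u n) (y * u n.+1 y) by case/IH.
have d1 (y : R) : y != 0 -> is_derive y 1 (u n.+1) (y * u n.+2 y) by case/IH.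
have rec (y : R) : y != 0 -> y ^+ 2 * u n.+2 y = - (n.*2.+1%:R * u n.+1 y + u n y).
  by case/IH.
have d2 (y : R) : y != 0 -> derivable (u n.+2) y 1 ->
    is_derive y 1 (u n.+2) (y * u n.+3 y) by exact: rayleigh_derivableP.
have [i2 rec'] := three_term_shift d0 d1 d2 rec x0.
split; [exact: d1|exact: i2|].
have -> : n.+1.*2.+1%:R = n.*2.+1%:R + 2 :> R by rewrite -natrD doubleS addn2.
exact: rec'.
Qed.

Lemma rayleigh_derive n (x : R) : x != 0 -> is_derive x 1 (u n) (x * u n.+1 x).
Proof. by case/(rayleigh_derive_rec n). Qed.

Lemma rayleigh_rec n (x : R) : x != 0 ->
  x ^+ 2 * u n.+2 x = - (n.*2.+1%:R * u n.+1 x + u n x).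
Proof. by case/(rayleigh_derive_rec n). Qed.

Lemma rayleigh_rec_div n (x : R) : x != 0 ->
  u n.+2 x = - (n.*2.+1%:R * u n.+1 x + u n x) / x ^+ 2.
Proof.
move=> x0; rewrite -(rayleigh_rec n x0) mulrC mulKf//.
by rewrite expf_neq0.
Qed.

(** The recurrence run downwards would make sin x and cos x vanish together. *)
Lemma rayleigh_consecutive_neq0 n (x : R) : x != 0 -> u n x = 0 -> u n.+1 x <> 0.
Proof.
move=> x0; elim: n => [|n IH] un un1.
  move: un un1; rewrite rayleigh1; rewrite rayleigh0 => s0 /eqP.
  rewrite mulf_eq0 invr_eq0 (negbTE x0) orbF => /eqP c0.
  by have /eqP := cos2Dsin2 x; rewrite s0 c0 expr0n addr0 eq_sym oner_eq0.
apply: IH (un) => //; have /eqP := rayleigh_rec n x0.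
by rewrite un un1 !mulr0 add0r eq_sym oppr_eq0 => /eqP.
Qed.

Lemma rayleigh_odd n (x : R) : x != 0 -> u n (- x) = - u n x.
Proof.
move=> x0; suff [] : u n (- x) = - u n x /\ u n.+1 (- x) = - u n.+1 x by [].
elim: n => [|n [IH0 IH1]].
  split; first exact: sinN.
  by rewrite rayleigh1 cosN invrN mulrN.
split; first exact: IH1.
have Nx0 : - x != 0 by rewrite oppr_eq0.
rewrite (rayleigh_rec_div n x0) (rayleigh_rec_div n Nx0) IH0 IH1 sqrrN.
by rewrite mulrN -opprD mulNr.
Qed.

(** By the recurrence, v_n = x^(2n+1) u_{n+1} satisfies
v_{n+2} = - (2n+3) v_{n+1} - x^2 v_n, so the limits at 0 are multiplied by
- (2n+3) at each step; d is the double factorial (2n-1)!!. *)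
Lemma rayleigh_cvg0 n : exists2 d : R, 0 < d &
  x ^+ n.*2.+1 * u n.+1 x @[x --> 0^'] --> (-1) ^+ n * d.
Proof.
pose v k x : R := x ^+ k.*2.+1 * u k.+1 x.
have x_0 : (fun x : R => x) @ 0^' --> (0 : R).
  exact: (continuous_withinNx (@idfun R) 0).1 (@cvg_id _ _).
have sin0' : (fun x : R => sin x) @ 0^' --> (0 : R).
  by have := (continuous_withinNx (@sin R) 0).1 (@continuous_sin R 0); rewrite sin0; apply.
have v0 : v 0 x @[x --> 0^'] --> (1 : R).
  apply: (@cvg_trans _ (cos x @[x --> 0^'])).
    apply: near_eq_cvg; near=> x; rewrite /v rayleigh1 expr1 mulrC divfK//.
    by near: x; exact: nbhs_dnbhs_neq.
  by have := (continuous_withinNx (@cos R) 0).1 (@continuous_cos R 0); rewrite cos0; apply.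
have v1 : v 1 x @[x --> 0^'] --> (-1 : R).
  apply: (@cvg_trans _ (- v 0 x - x * sin x @[x --> 0^'])).
    apply: near_eq_cvg; near=> x.
    have x0 : x != 0 by near: x; exact: nbhs_dnbhs_neq.
    rewrite /v (_ : 1.*2.+1 = 3)%N// [x ^+ 3]exprS -[RHS]mulrA.
    rewrite (rayleigh_rec 0 x0) double0 mul1r expr1.
    by rewrite rayleigh0; ring.
  have -> : (-1 : R) = - 1 - 0 * 0 by rewrite mulr0 subr0.
  by apply: cvgB; [exact: cvgN|exact: cvgM].
have v2 k x : x != 0 -> v k.+2 x = - (k.+1.*2.+1%:R * v k.+1 x) - x ^+ 2 * v k x.
  move=> x0; rewrite /v.
  have -> : k.+2.*2.+1 = (k.+1.*2.+1 + 2)%N by rewrite !doubleS addn2.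
  rewrite exprD -mulrA (rayleigh_rec k.+1 x0) mulrN mulrDr opprD; congr (_ - _).
    by rewrite mulrCA.
  by rewrite mulrA -exprD !doubleS.
suff [d [d' [d0 d'0 vd vd']]] : exists d d' : R, [/\ 0 < d, 0 < d',
    v n x @[x --> 0^'] --> (-1) ^+ n * d & v n.+1 x @[x --> 0^'] --> (-1) ^+ n.+1 * d'].
  by exists d.
elim: n => [|n [d [d' [d0 d'0 vd vd']]]].
  by exists 1, 1; rewrite expr0 expr1 !mulr1; split.
exists d', (n.+1.*2.+1%:R * d'); split=> //; first exact: mulr_gt0.
apply: (@cvg_trans _ (- (n.+1.*2.+1%:R * v n.+1 x) - x ^+ 2 * v n x @[x --> 0^'])).
  apply: near_eq_cvg; near=> x; rewrite v2//; near: x; exact: nbhs_dnbhs_neq.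
have -> : (-1) ^+ n.+2 * (n.+1.*2.+1%:R * d') =
    - (n.+1.*2.+1%:R * ((-1) ^+ n.+1 * d')) - 0 ^+ 2 * ((-1) ^+ n * d).
  by rewrite expr0n /= mul0r subr0 !exprS; ring.
apply: cvgB; first by apply: cvgN; apply: cvgMr.
by apply: cvgM => //; rewrite expr2; exact: cvgM.
Unshelve. all: by end_near. Qed.

End Rayleigh.

(** * The spherical Bessel function of the second kind *)

Section BesselY.
Context {R : realType} (n : nat).
Local Notation u := (@rayleigh_iterate R).
Local Notation y := (@sph_bessel_y R n).

(** The derivative of y_n is (-x)^n / x times h 0, and h (j + 1) is the image of
h j under x^-1 d/dx. *)
Let h j x : R := n.+1%:R * u (n + j).+1 x + u (n + j) x.
Definition sph_bessel_y' (x : R) : R := (- x) ^+ n / x * h 0 x.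

Lemma sph_bessel_y_derive (x : R) : x != 0 -> is_derive x 1 y (sph_bessel_y' x).
Proof.
move=> x0.
have -> : y = (fun x => - (- x) ^+ n * u n.+1 x).
  by apply/funext => z; rewrite sph_bessel_yE.
have i1 := rayleigh_derive n.+1 x0.
have i2 : is_derive x 1 (fun x : R => - (- x) ^+ n) (n%:R * (- x) ^+ n / x * - 1).
  have dN : is_derive x 1 (fun x : R => - x) (- 1) by exact: is_deriveN.
  have -> : (fun x : R => - (- x) ^+ n) = - (fun x => - x) ^+ n.
    by apply/funext => z; rewrite fctE exprfctE.
  apply: is_derive_eq (is_deriveN (is_deriveX n dN)) _.
  rewrite /GRing.scale /=; case: n => [|k]; first by rewrite !mul0r oppr0.
  rewrite exprS /=; field.
  exact: x0.
apply: is_derive_eq (is_deriveM i2 i1) _.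
rewrite /GRing.scale /= /sph_bessel_y' /h addn0.
have -> : (x * u n.+2 x) = - (n.*2.+1%:R * u n.+1 x + u n x) / x.
  by rewrite -(rayleigh_rec n x0); field.
rewrite -!natr1 -muln2 natrM; field.
exact: x0.
Qed.

Let h_derive j (x : R) : x != 0 -> is_derive x 1 (h j) (x * h j.+1 x).
Proof.
move=> x0; have i0 := rayleigh_derive (n + j) x0.
have i1 := rayleigh_derive (n + j).+1 x0.
apply: is_derive_eq (is_deriveD (is_deriveZ n.+1%:R i1) i0) _.
by rewrite /GRing.scale /= /h addnS mulrDr mulrCA.
Qed.

Let h_cont j (x : R) : x != 0 -> {for x, continuous (h j)}.
Proof.
move=> /(h_derive j) dx; apply: differentiable_continuous.
by apply/derivable1_diffP; case: dx.
Qed.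

(** If h 0, h 1 and h 2 vanish at x, then u_{n+1} and u_n are multiples of
u_{n+2}, which is therefore not zero. The recurrence at n then gives
x^2 = n (n + 1), and the recurrence at n + 1 gives x^2 = (n + 1)(n + 2). *)
Let h012_neq0 (x : R) : x != 0 -> h 0 x = 0 -> h 1 x = 0 -> h 2 x <> 0.
Proof.
move=> x0; rewrite /h !addnS addn0.
have := rayleigh_rec n x0; have := rayleigh_rec n.+1 x0.
have := @rayleigh_consecutive_neq0 _ n _ x0.
rewrite doubleS -!natr1 -muln2 natrM.
move: (u n x) (u n.+1 x) (u n.+2 x) (u n.+3 x) => U0 U1 U2 U3 nz r1 r0 h0 h1 h2.
have n0 : 0 <= n%:R :> R by [].
move: (n%:R : R) n0 r0 r1 h0 h1 h2 => N N0 r0 r1 h0 h1 h2.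
have e1 : U1 = - (N + 1) * U2 by lra.
have e0 : U0 = (N + 1) ^+ 2 * U2.
  have -> : U0 = - (N + 1) * U1 by lra.
  by rewrite e1; ring.
have U2n0 : U2 != 0.
  by apply/eqP => U20; apply: nz; rewrite ?e0 ?e1 U20 mulr0.
have xx : x ^+ 2 = N * (N + 1).
  by apply: (mulIf U2n0); rewrite r0 e0 e1; ring.
have : U2 * 2 * (N + 1) = 0.
  have -> : U2 * 2 * (N + 1) = (N + 1) * (x ^+ 2 * U3 + (N * 2 + 3) * U2 + U1) -
     x ^+ 2 * ((N + 1) * U3 + U2).
    rewrite xx e1; ring.
  by rewrite h2 mulr0 r1; ring.
by move/eqP; rewrite !mulf_eq0 (negbTE U2n0) pnatr_eq0 /= gt_eqF//; lra.
Qed.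

Lemma sph_bessel_y'_cont (x : R) : x != 0 -> {for x, continuous sph_bessel_y'}.
Proof.
move=> x0; apply: cvgM; last exact: h_cont.
apply: cvgM; last by apply: cvgV.
apply: (@continuous_comp _ _ _ -%R (fun t : R => t ^+ n)).
  exact: opp_continuous.
exact: exprn_continuous.
Qed.

(** One of h 0, h 1 and h 2 is nonzero at a, hence near a; isolation of zeros
then descends to h 0, since the derivative of h j is x h (j + 1). *)
Let h_isolated (a : R) : a != 0 -> isolated_zero (h 0) a.
Proof.
move=> a0.
have down j : isolated_zero (h j.+1) a -> isolated_zero (h j) a.
  move=> hj; apply: (@isolated_zero_deriv _ _ (fun x => x * h j.+1 x) a `|a|).
  - by rewrite normr_gt0.
  - move=> x xa; apply: h_derive; apply: contraTneq xa => ->.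
    by rewrite sub0r normrN ltxx.
  - exact: isolated_zero_mulx.
have [h0|] := eqVneq (h 0 a) 0; last by apply: isolated_zero_cont; exact: h_cont.
have [h1|] := eqVneq (h 1 a) 0; last first.
  by move=> h1; apply: down; apply: isolated_zero_cont h1; exact: h_cont.
apply/(down 0)/(down 1); apply: isolated_zero_cont; first exact: h_cont.
by apply/eqP; exact: (h012_neq0 a0 h0 h1).
Qed.

(** Near 0 the term in u_{n+1} dominates. *)
Let h_isolated0 : isolated_zero (h 0) 0.
Proof.
have [d d0 vd] := @rayleigh_cvg0 R n.
have w0 : x ^+ n.*2.+1 * u n x @[x --> (0 : R)^'] --> (0 : R).
  case: (n) => [|k].
    suff : x ^+ 0.*2.+1 * u 0 x @[x --> (0 : R)^'] --> (0 : R) * sin 0 by rewrite mul0r.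
    apply: (@cvg_trans _ (x * sin x @[x --> (0 : R)^'])).
      by apply: near_eq_cvg; near=> x; rewrite rayleigh0.
    apply: cvgM; first exact: (continuous_withinNx (@idfun R) 0).1 (@cvg_id _ _).
    exact: (continuous_withinNx (@sin R) 0).1 (@continuous_sin R 0).
  have [d' _ vd'] := @rayleigh_cvg0 R k.
  suff : x ^+ k.+1.*2.+1 * u k.+1 x @[x --> (0 : R)^'] --> (0 : R) ^+ 2 * ((-1) ^+ k * d').
    by rewrite expr0n mul0r.
  apply: (@cvg_trans _ (x ^+ 2 * (x ^+ k.*2.+1 * u k.+1 x) @[x --> (0 : R)^'])).
    by apply: near_eq_cvg; near=> x; rewrite mulrA -exprD doubleS.
  apply: cvgM => //.
  exact: (continuous_withinNx (fun x : R => x ^+ 2) 0).1 (@exprn_continuous _ 2 0).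
have wd : n.+1%:R * (x ^+ n.*2.+1 * u n.+1 x) + x ^+ n.*2.+1 * u n x @[x --> 0^']
    --> n.+1%:R * ((-1) ^+ n * d) + 0.
  by apply: cvgD => //; exact: cvgMr.
have lim_neq0 : n.+1%:R * ((-1) ^+ n * d) + 0 != 0.
  by rewrite addr0 !mulf_neq0 ?pnatr_eq0 ?signr_eq0// gt_eqF.
apply/isolated_zeroP; near=> x.
have : n.+1%:R * (x ^+ n.*2.+1 * u n.+1 x) + x ^+ n.*2.+1 * u n x != 0.
  by near: x; exact: (cvgr_neq0 _ wd lim_neq0).
apply: contraNneq; rewrite /h addn0 => hx; rewrite mulrCA -mulrDr hx mulr0.
Unshelve. all: by end_near. Qed.

Lemma sph_bessel_y'_isolated (a : R) : isolated_zero sph_bessel_y' a.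
Proof.
have : isolated_zero (h 0) a.
  by have [->|a0] := eqVneq a 0; [exact: h_isolated0|exact: h_isolated].
move=> /isolated_zeroP ha; apply/isolated_zeroP; near=> x.
have x0 : x != 0.
  near: x; have [->|a0] := eqVneq a 0; first exact: nbhs_dnbhs_neq.
  by apply: nbhs_dnbhs; exact: near_neq0.
rewrite mulf_neq0//; last by near: x.
by rewrite mulf_neq0 ?invr_eq0// expf_neq0// oppr_eq0.
Unshelve. all: by end_near. Qed.

Lemma sph_bessel_y_pole (c d : R) : 0 < d -> exists x, [/\ 0 < x, x < d & y x < c].
Proof.
move=> d0; have [e e0 ve] := @rayleigh_cvg0 R n.
have ve' : x ^+ n.+1 * y x @[x --> 0^'] --> - e.
  apply: (@cvg_trans _ (- (-1) ^+ n * (x ^+ n.*2.+1 * u n.+1 x) @[x --> 0^'])).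
    apply: near_eq_cvg; near=> x.
    by rewrite sph_bessel_yE [(- x) ^+ n]exprNn -addnn -addSn exprD; ring.
  have -> : - e = - (-1) ^+ n * ((-1) ^+ n * e).
    by rewrite mulrA mulNr -expr2 sqrr_sign mulN1r.
  exact: cvgMr.
have lt0 : - e < - (e / 2) by lra.
have : \forall x \near (0 : R)^', x ^+ n.+1 * y x < - (e / 2).
  exact: (cvgr_lt _ ve' _ lt0).
move=> /nbhs_ballP[r /= r0 Hr].
pose C := `|c| + 1.
have C0 : 0 < C by rewrite /C ltr_wpDl.
pose m := Num.min (Num.min 1 d) (Num.min r (e / 2 / C)).
have eC : 0 < e / 2 / C by rewrite !divr_gt0.
have m0 : 0 < m by rewrite !lt_min d0 r0 eC ltr01.
pose x := m / 2.
have xm : x < m by rewrite /x; lra.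
have x0 : 0 < x by rewrite /x; lra.
move: xm; rewrite !lt_min => /andP[/andP[x1 xd] /andP[xr xe]].
exists x; split=> //.
have fx : x ^+ n.+1 * y x < - (e / 2).
  by apply: Hr; rewrite /ball/= ?sub0r ?normrN ?gtr0_norm// gt_eqF.
have y0 : y x < 0.
  by rewrite -(pmulr_rlt0 _ (exprn_gt0 n.+1 x0)); lra.
have xn : x ^+ n.+1 <= x by rewrite exprS ler_piMr ?(ltW x0)// exprn_ile1// ltW.
have le1 : x * y x <= x ^+ n.+1 * y x by rewrite ler_nM2r.
have xC : x * C < e / 2 by rewrite -ltr_pdivlMr.
have lt2 : x * y x < x * - C by rewrite mulrN; lra.
rewrite ltr_pM2l// in lt2; apply: (lt_le_trans lt2).
by have := ler_norm (- c); rewrite normrN /C; lra.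
Unshelve. all: by end_near. Qed.

Lemma sph_bessel_y_parity (x : R) : x != 0 -> y (- x) = - (-1) ^+ n * y x.
Proof.
move=> x0; rewrite !sph_bessel_yE rayleigh_odd// opprK [(- x) ^+ n]exprNn.
have := sqrr_sign R n; rewrite expr2 => e.
transitivity (((-1) ^+ n * (-1) ^+ n) * (x ^+ n * u n.+1 x)); last ring.
by rewrite e; ring.
Qed.

End BesselY.

(** A nonzero polynomial in 1/x has eventually constant sign. *)
Lemma poly_inv_sign {R : realType} (P : {poly R}) : P != 0 ->
  exists s N : R, forall x, N < x -> 0 < s * P.[x^-1].
Proof.
move=> P0; have [m [Q /implyP/(_ P0) Q0 ->]] := multiplicity_XsubC P 0.
have Qc : {for 0, continuous (horner Q)} by exact: continuous_horner.
have QQ : Q.[0] * Q.[t] @[t --> (0 : R)] --> Q.[0] * Q.[0] by exact: cvgMr.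
have QQ0 : 0 < Q.[0] * Q.[0] by rewrite -expr2 exprn_even_gt0.
have : \forall t \near (0 : R), 0 < Q.[0] * Q.[t] by exact: (cvgr_gt _ QQ _ QQ0).
move=> /nbhs_ballP[e /= e0 He].
exists Q.[0], (e^-1) => x xe.
have x0 : 0 < x by apply: lt_trans xe; rewrite invr_gt0.
rewrite hornerM horner_exp hornerXsubC subr0 mulrA mulr_gt0 ?exprn_gt0 ?invr_gt0//.
apply: He; rewrite /ball/= sub0r normrN gtr0_norm ?invr_gt0//.
by rewrite -[e]invrK ltf_pV2 ?posrE ?invr_gt0.
Qed.

Lemma alternating_oscillates {R : realType} (f : R -> R) (s N : R) (t : nat -> R) :
    (forall k, k%:R <= t k) ->
    (forall k, N < t k -> 0 < s * ((-1) ^+ k * f (t k))) ->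
  forall M : R, (exists2 x, M < x & 0 < f x) /\ (exists2 x, M < x & f x < 0).
Proof.
move=> tk sf M; pose k := (Num.bound `|Num.max N M|).*2.
have kNM : Num.max N M < k%:R.
  apply: (le_lt_trans (ler_norm _)); apply: (lt_le_trans (archi_boundP (normr_ge0 _))).
  by rewrite ler_nat /k -addnn leq_addr.
have kNM' : Num.max N M < k.+1%:R by apply: (lt_trans kNM); rewrite ltr_nat.
have /andP[Nk Mk] : (N < t k) && (M < t k) by rewrite -gt_max (lt_le_trans kNM).
have /andP[Nk' Mk'] : (N < t k.+1) && (M < t k.+1).
  by rewrite -gt_max (lt_le_trans kNM').
have even_k : (-1) ^+ k = 1 :> R by rewrite -signr_odd odd_double.
have := sf _ Nk; have := sf _ Nk'; rewrite exprS even_k mulr1 mulN1r mul1r.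
have [s0|s0|<-] := ltgtP 0 s; last by rewrite mul0r ltxx.
  rewrite !pmulr_rgt0// oppr_gt0 => f1 f0.
  by split; [exists (t k)|exists (t k.+1)].
rewrite !nmulr_rgt0// oppr_lt0 => f1 f0.
by split; [exists (t k.+1)|exists (t k)].
Qed.

Lemma cos_mulpi {R : realType} k : cos (pi *+ k) = (-1) ^+ k :> R.
Proof.
elim: k => [|k IH]; first by rewrite mulr0n cos0.
by rewrite mulrSr cosDpi IH exprS mulN1r.
Qed.

Lemma sin_mulpi {R : realType} k : sin (pi *+ k) = 0 :> R.
Proof.
elim: k => [|k IH]; first by rewrite mulr0n sin0.
by rewrite mulrSr sinDpi IH oppr0.
Qed.

Section Oscillation.
Context {R : realType} (n : nat) (p q : {poly int}) (hpq : forall x : R, x != 0 ->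
  sph_bessel_y n x = laurent_eval p x * cos x + laurent_eval q x * sin x).

(** At the points k pi the value is (-1)^k p(1/x), which alternates in sign; if
p = 0 the points k pi + pi / 2 and q do the same. Both cannot be zero, since y_n
is not. *)
Lemma sph_bessel_y_oscr (M : R) :
  (exists2 x, M < x & 0 < sph_bessel_y n x) /\ (exists2 x, M < x & sph_bessel_y n x < 0).
Proof.
have pi2 : (2 : R) <= pi by have := pihalf_ge1 R; lra.
have kpi k : k%:R <= pi *+ k :> R.
  by rewrite -[leRHS]mulr_natr ler_peMl//; lra.
pose P : {poly R} := map_poly intr p; pose Q : {poly R} := map_poly intr q.
have sqr1 k : (-1) ^+ k * (-1) ^+ k = 1 :> R by rewrite -expr2 sqrr_sign.
have [P0|/poly_inv_sign[s [N sN]]] := eqVneq P 0; last first.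
  apply: (@alternating_oscillates _ _ s (Num.max N 0) (fun k => pi *+ k)) => // k.
  rewrite gt_max => /andP[Nk k0]; rewrite hpq ?gt_eqF// cos_mulpi sin_mulpi mulr0 addr0.
  by rewrite [X in s * X]mulrCA sqr1 mulr1 sN.
have [Q0|/poly_inv_sign[s [N sN]]] := eqVneq Q 0.
  have [x [x0 _]] := @sph_bessel_y_pole R n 0 1 ltr01.
  by rewrite hpq ?gt_eqF// /laurent_eval -/P -/Q P0 Q0 !horner0 !mul0r addr0 ltxx.
apply: (@alternating_oscillates _ _ s (Num.max N 0) (fun k => pi *+ k + pi / 2)).
  by move=> k; apply: (le_trans (kpi k)); lra.
move=> k; rewrite gt_max => /andP[Nk k0]; rewrite hpq ?gt_eqF//.
rewrite cosDpihalf sinDpihalf cos_mulpi sin_mulpi oppr0 mulr0 add0r.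
by rewrite [X in s * X]mulrCA sqr1 mulr1 sN.
Qed.

Lemma sph_bessel_y_oscl (M : R) :
  (exists2 x, x < M & 0 < sph_bessel_y n x) /\ (exists2 x, x < M & sph_bessel_y n x < 0).
Proof.
have [[x xM fx] [z zM fz]] := sph_bessel_y_oscr (Num.max (- M) 0).
move: xM zM; rewrite !gt_max => /andP[xM x0] /andP[zM z0].
have := sph_bessel_y_parity n (lt0r_neq0 x0).
have := sph_bessel_y_parity n (lt0r_neq0 z0).
rewrite -signr_odd; case: (odd n); rewrite ?expr0 ?expr1 ?opprK ?mul1r ?mulN1r => fz' fx'.
  by split; [exists (- x)|exists (- z)]; rewrite ?fx' ?fz'//; lra.
by split; [exists (- z)|exists (- x)]; rewrite ?fx' ?fz' ?oppr_gt0 ?oppr_lt0//; lra.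
Qed.

End Oscillation.

Theorem proposition1 (R : realType) (n : nat) (c0 : R) (p q : {poly int})
    (hp : strict_laurent p) (hq : strict_laurent q)
    (hpq : forall x : R, x != 0 ->
       sph_bessel_y n x = laurent_eval p x * cos x + laurent_eval q x * sin x) :
  [set x : R | x != 0 /\
     laurent_eval p x * cos x + laurent_eval q x * sin x = c0]
  = [set inverse_branch [set x : R | x != 0] (sph_bessel_y n) b c0 |
       b in [set b : int |
         branch_value_interval [set x : R | x != 0] (sph_bessel_y n) b c0]].
Proof.
rewrite -(branch_inverses_solve (@sph_bessel_y_derive R n)
  (@sph_bessel_y'_cont R n) (@sph_bessel_y'_isolated R n)
  (@sph_bessel_y_pole R n) (sph_bessel_y_oscr hpq) (sph_bessel_y_oscl hpq)).
by apply/seteqP; split=> x /= [x0]; rewrite -hpq.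
Qed.
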